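(* MonoBandit(TreeSwap) is a monotone algorithm and $$\mathrm{SReg}_{\mathrm{MonoBandit(TreeSwap)}}(T)=2\sqrt k\cdot o(T),$$ where $\mathrm{SReg}(T)$ is the swap regret over $T$ rounds against an arbitrary adaptive adversary.
   Context: Bandit online learning with $k$ actions over $T$ rounds. In each round $t$ an adaptive adversary picks a loss vector $\ell^t\in[0,1]^k$ as a function of the transcript of previous rounds (observed losses, selected actions, random bits used by the algorithm). The algorithm picks an action $s^t$ from its history and fresh randomness and observes only $\ell^t[s^t]$. In the full-information setting it observes the whole vector. Swap regret is $\max_{\chi:[k]\to[k]}\mathbb E[\sum_{t=1}^T(\ell^t[s^t]-\ell^t[\chi(s^t)])]$; external regret is $\max_{i\in[k]}\mathbb E[\sum_{t=1}^T(\ell^t[s^t]-\ell^t[i])]$. Both compare with the realized loss vectors. The statement $\mathrm{SReg}(T)=2\sqrt k\cdot o(T)$ is an upper bound on swap regret, in the usual Landau sense, as $T\to\infty$ with $k$ fixed. Monotonicity. The algorithm is used as a selection mechanism by a Principal who in each round selects one of the actions (agents, or an outside option) and observes its return; returns are negated losses, so a higher return is a lower loss. A Principal transcript is the sequence $\pi^{1:t}=((i^1,r^1),\dots,(i^t,r^t))$ of selected actions and their realized returns. A selection mechanism $f$ consists of deterministic maps $f^t$ that take the transcript of the preceding rounds and the randomness $\mathcal R$ used by the mechanism, and output the action selected in round $t$. Let $\pi$ be an arbitrary Principal transcript, and let $\tilde\pi$ be another Principal transcript identical to $\pi$ except in exactly one entry $t$, where $\pi^t=(i,r)$ and $\tilde\pi^t=(i,\tilde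 r)$ with the same selected action $i$ and $\tilde r\ge r$. The mechanism $f$ is monotone if, for all such $\pi,\tilde\pi$ and all $t'\ge t$, $$\Pr_{\mathcal R}[f^{t'+1}(\tilde\pi^{1:t'},\mathcal R)=i]\ \ge\ \Pr_{\mathcal R}[f^{t'+1}(\pi^{1:t'},\mathcal R)=i].$$ MonoBandit$(\mathcal A)$, for a full-information algorithm $\mathcal A$ and a parameter $\epsilon\in(0,1]$: maintain a distribution $p$ over actions, initially uniform. In each round, with probability $1-\epsilon$ (exploit) play an action drawn from $p$ and append the zero vector to the sequence of loss vectors fed to $\mathcal A$; with probability $\epsilon/k$ for each action $j$ (explore) play $j$, observe its loss $b$, and append the vector with $j$-th entry $kb/\epsilon$ and all other entries $0$. Then set $p$ to the output of $\mathcal A$ on the sequence of vectors so far. The explore/exploit randomness is independent of the randomness of $\mathcal A$ and independent across rounds. Here $\epsilon=\min\{1,\sqrt{kR(T)/T}\}$, where $R(T)$ is a swap-regret bound for $\mathcal A$ per unit of loss range (for losses in an interval of length $c$ the regret is at most $cR(T)$). TreeSwap (Dagan et al.), a full-information algorithm, with integers $M,d$ such that $M^{d-1}\le T\le M^d$ and a base full-information external-regret algorithm: for every $h\in\{1,\dots,d\}$ and $\sigma\in\{0,\dots,M-1\}^{h-1}$ there is a separate instance $\mathrm{Alg}_\sigma$ of the base algorithm with horizon $M$. In round $t$ let $(\sigma_1,\dots,\sigma_d)$ be the base-$M$ digits of $t-1$. For each $h$, let $x_h^t$ be the distribution output by $\mathrm{Alg}_{(\sigma_1,\dots,\sigma_{h-1})}$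 after receiving, for each of its $\sigma_h$ completed blocks of $M^{d-h}$ consecutive rounds, the average loss vector of that block. TreeSwap plays $\frac1d\sum_{h=1}^d x_h^t$. The base algorithm is a monotone no-external-regret algorithm, and $M,d$ are chosen depending on $T,k$ so that TreeSwap has swap regret $o(T)$ (a result of Dagan et al.). *)

(* Defs.v *)
From HB Require Import structures.
From mathcomp Require Import all_boot all_order all_algebra.
From mathcomp Require Import all_classical all_reals all_analysis.
Set Implicit Arguments.
Unset Strict Implicit.
Unset Printing Implicit Defensive.
Import Order.TTheory GRing.Theory Num.Theory.
Import numFieldNormedType.Exports.
Local Open Scope classical_set_scope.
Local Open Scope ring_scope.

(* Rounds are indexed from 0: a history of length t is what is known at the
   beginning of the round with index t. *)

Section FullInformation.
Context {R : realType} {k : nat}.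

Definition vec := 'I_k -> R.

Definition is_dist (p : vec) : Prop :=
  (forall i, 0 <= p i) /\ \sum_i p i = 1.

(* A full-information algorithm maps the loss vectors of the past rounds to the
   distribution from which the action of the current round is drawn.  Its
   output does not depend on its past draws, so its expected regret is
   determined by the sequence of loss vectors. *)
Definition fi_alg := seq vec -> vec.

Definition losses_in (a c : R) T (ls : T.-tuple vec) : Prop :=
  forall (t : 'I_T) i, a <= tnth ls t i <= a + c.

Definition fi_external_regret (A : fi_alg) T (ls : T.-tuple vec) (i : 'I_k) : R :=
  \sum_(t < T) \sum_j A (take t ls) j * (tnth ls t j - tnth ls t i).

(* The default value 0 of the maximum is the value at the identity. *)
Definition fi_swap_regret (A : fi_alg) T (ls : T.-tuple vec) : R :=
  \big[Num.max/0]_(chi : {ffun 'I_k -> 'I_k})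
    \sum_(t < T) \sum_j A (take t ls) j * (tnth ls t j - tnth ls t (chi j)).

(* Lowering the loss of i in one past round does not lower the probability of
   i in any of the N rounds that follow it. *)
Definition fi_monotone (N : nat) (A : fi_alg) : Prop :=
  forall (ls ls' : N.-tuple vec) (t : 'I_N) (i : 'I_k),
    (forall s j, (s, j) != (t, i) -> tnth ls' s j = tnth ls s j) ->
    tnth ls' t i <= tnth ls t i ->
    forall t' : nat, (t < t' < N)%N ->
      A (take t' ls) i <= A (take t' ls') i.

(* A base algorithm may be tuned to the length of the interval containing the
   losses (first argument) and to the horizon (second argument).  Algorithms
   that do not need to know the range are those constant in it. *)
Definition base_alg := R -> nat -> fi_alg.

Definition no_external_regret (base : base_alg) : Prop :=
  exists B : nat -> R, B =o_\oo (fun N => N%:R : R) /\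
  forall (N : nat) (c a : R) (ls : N.-tuple vec) (i : 'I_k), 0 < c ->
    losses_in a c ls -> fi_external_regret (base c N) ls i <= c * B N.

End FullInformation.

Arguments vec : clear implicits.
Arguments fi_alg : clear implicits.
Arguments base_alg : clear implicits.

Section TreeSwap.
Context {R : realType} {k : nat}.
Variables (base : base_alg R k) (c : R) (M d : nat).

(* h-th most significant base-M digit of n, for 1 <= h <= d *)
Definition digit (n h : nat) : nat := ((n %/ M ^ (d - h)) %% M)%N.

Definition node (n h : nat) : seq nat := [seq digit n j | j <- iota 1 h.-1].

(* first round in which the instance at the node sigma is active *)
Definition node_start (sigma : seq nat) : nat :=
  (\sum_(j < size sigma) nth 0 sigma j * M ^ (d - j.+1))%N.

Definition block_average (ls : seq (vec R k)) (start len : nat) : vec R k :=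
  fun i => (\sum_(u < len) nth (fun=> 0) ls (start + u)%N i) / len%:R.

Definition level_dist (ls : seq (vec R k)) (h : nat) : vec R k :=
  let n := size ls in
  let len := (M ^ (d - h))%N in
  base c M [seq block_average ls (node_start (node n h) + b * len)%N len
           | b <- iota 0 (digit n h)].

Definition tree_swap : fi_alg R k :=
  fun ls i => d%:R^-1 * \sum_(1 <= h < d.+1) level_dist ls h i.

End TreeSwap.

Section SelectionMechanism.
Context {R : realType} {k : nat} {disp : measure_display}.
Context {Omega : measurableType disp}.

(* Selected actions with their realized returns. *)
Definition ptranscript := seq ('I_k * R).

(* f^(t+1) is the restriction to transcripts of length t; Omega carries the
   randomness of the mechanism. *)
Definition mechanism := ptranscript -> Omega -> 'I_k.

Definition monotone_mechanism (P : probability Omega R) (T : nat)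
    (f : mechanism) : Prop :=
  forall (pi pi' : T.-tuple ('I_k * R)) (t : 'I_T) (i : 'I_k) (r r' : R),
    (forall s, s != t -> tnth pi' s = tnth pi s) ->
    tnth pi t = (i, r) -> tnth pi' t = (i, r') -> r <= r' ->
    forall t' : nat, (t < t' < T)%N ->
      (P [set w | f (take t' pi) w = i] <= P [set w | f (take t' pi') w = i])%E.

Variable bitsT : Type.

(* Loss vector, selected action and random bits of one round. *)
Record round_record := RoundRecord {
  rr_loss : vec R k; rr_action : 'I_k; rr_bits : bitsT }.

Definition adversary := seq round_record -> vec R k.

Definition principal_view (h : seq round_record) : ptranscript :=
  [seq (rr_action x, - rr_loss x (rr_action x)) | x <- h].

(* The first t rounds of the interaction; [bits] gives the random bits used by
   the mechanism in the round following a transcript. *)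
Fixpoint interaction (f : mechanism) (bits : ptranscript -> Omega -> bitsT)
    (adv : adversary) (t : nat) (w : Omega) : seq round_record :=
  if t is t'.+1 then
    let h := interaction f bits adv t' w in
    let pi := principal_view h in
    rcons h (RoundRecord (adv h) (f pi w) (bits pi w))
  else [::].

Definition swap_regret (P : probability Omega R) (f : mechanism)
    (bits : ptranscript -> Omega -> bitsT) (adv : adversary) (T : nat) : \bar R :=
  \big[Order.max/0%E]_(chi : {ffun 'I_k -> 'I_k})
    ('E_P[fun w => (\sum_(x <- interaction f bits adv T w)
           (rr_loss x (rr_action x) - rr_loss x (chi (rr_action x))))%R])%E.

End SelectionMechanism.

Arguments ptranscript : clear implicits.
Arguments mechanism : clear implicits.
Arguments adversary : clear implicits.

Section MonoBandit.
Context {R : realType} {k : nat} {disp : measure_display}.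
Context {Omega : measurableType disp}.

(* [coin t w] is [Some j] to explore j, [None] to exploit; [draw t p w] is the
   action drawn from p. *)
Definition coinT := nat -> Omega -> option 'I_k.
Definition drawT := nat -> vec R k -> Omega -> 'I_k.

Definition coin_prob (eps : R) (e : option 'I_k) : R :=
  if e is Some _ then eps / k%:R else 1 - eps.

(* Coins and draws have the required laws and are mutually independent, over
   all T rounds and for any choice of one distribution per round.  A sequence
   of coins with an independent sequence of uniform reals turned into draws by
   inverting the distribution function of p is an instance. *)
Definition mono_bandit_randomness (P : probability Omega R) (T : nat) (eps : R)
    (coin : coinT) (draw : drawT) : Prop :=
  [/\ forall t e, measurable [set w | coin t w = e],
      forall t p a, is_dist p -> measurable [set w | draw t p w = a] &
      forall (p : 'I_T -> vec R k) (e : 'I_T -> option 'I_k) (a : 'I_T -> 'I_k),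
        (forall t, is_dist (p t)) ->
        P [set w | forall t : 'I_T, coin t w = e t /\ draw t (p t) w = a t] =
        (\prod_(t < T) (coin_prob eps (e t) * p t (a t)))%:E].

Variables (A : fi_alg R k) (eps : R) (coin : coinT) (draw : drawT).

Definition fed_vector (e : option 'I_k) (x : 'I_k * R) : vec R k :=
  fun i => if isSome e && (i == x.1) then k%:R * (- x.2) / eps else 0.

Definition fed_vectors (pi : ptranscript R k) (w : Omega) : seq (vec R k) :=
  [seq fed_vector (coin x.1 w) x.2 | x <- zip (iota 0 (size pi)) pi].

Definition current_dist (pi : ptranscript R k) (w : Omega) : vec R k :=
  if pi is [::] then fun=> k%:R^-1 else A (fed_vectors pi w).

Definition mono_bandit_bits (pi : ptranscript R k) (w : Omega) :
    option 'I_k * 'I_k :=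
  (coin (size pi) w, draw (size pi) (current_dist pi w) w).

Definition mono_bandit : mechanism R k _ Omega := fun pi w =>
  let: (e, a) := mono_bandit_bits pi w in if e is Some j then j else a.

End MonoBandit.

Arguments coinT k {disp} Omega.
Arguments drawT R k {disp} Omega.

Definition explore_rate {R : realType} (k : nat) (SR : nat -> R) (T : nat) : R :=
  Num.min 1 (Num.sqrt (k%:R * SR T / T%:R)).

(* The vectors fed to TreeSwap have entries in [0, k / eps]. *)
Definition mb_tree_swap_alg {R : realType} {k : nat} (base : base_alg R k)
    (M d : nat -> nat) (SR : nat -> R) (T : nat) : fi_alg R k :=
  tree_swap base (k%:R / explore_rate k SR T) (M T) (d T).

(* Main.v *)
(** Monotonicity passes from the base algorithm to TreeSwap level by level,
since modifying one round modifies at most one block average per level, and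
from TreeSwap to MonoBandit because, once the coins are fixed, raising the
return of [i] in a round can only lower the entry [i] of the vector fed in that
round.

For the swap regret, both the losses and the distribution used by the mechanism
are functions of the random bits of the past rounds, so expectations are finite
sums over the tree of bits.  The fed vectors estimate the losses without bias;
hence the realized regret, minus [1 - eps] times the regret of TreeSwap on the
fed vectors, minus [eps] per round, is a supermartingale, up to an error of at
most 2 in the first round, where the mechanism is uniform and TreeSwap need not
be.  On every path the regret of TreeSwap on the fed vectors is at most
[k / eps * SR T], so the swap regret is at most [eps T + k SR(T) / eps + 2],
which the choice of [eps] turns into [2 sqrt(k) sqrt(T SR(T)) + 2]. *)

Require Import Defs.
From HB Require Import structures.
From mathcomp Require Import all_boot all_order all_algebra.
From mathcomp Require Import all_classical all_reals all_analysis.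
From mathcomp Require Import ring lra.
Set Implicit Arguments.
Unset Strict Implicit.
Unset Printing Implicit Defensive.
Import Order.TTheory GRing.Theory Num.Theory.
Import numFieldNormedType.Exports.
Local Open Scope classical_set_scope.
Local Open Scope ring_scope.

(** * Normalization and monotonicity of TreeSwap *)

Section TreeSwap.
Context {R : realType} {k : nat}.

(** Restates [fi_monotone] for sequences shorter than the horizon. They are padded with zero vectors
    up to length [N]; zero is also the default of [nth], so the padding changes no entry. *)
Lemma fi_monotone_seq N (A : fi_alg R k) (ls ls' : seq (vec R k)) (t : nat) (i : 'I_k) :
  fi_monotone N A -> size ls' = size ls -> (t < size ls < N)%N ->
  (forall s j, (s, j) != (t, i) ->
     nth (fun=> 0) ls' s j = nth (fun=> 0) ls s j) ->
  nth (fun=> 0) ls' t i <= nth (fun=> 0) ls t i ->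
  A ls i <= A ls' i.
Proof.
move=> mA eqsz /andP[tls lsN] eqls le_t.
pose pad (l : seq (vec R k)) := l ++ nseq (N - size l) (fun=> 0).
have szpad l : (size l < N)%N -> size (pad l) == N.
  by move=> lN; rewrite size_cat size_nseq subnKC // ltnW.
have nthpad l s : nth (fun=> 0) (pad l) s = nth (fun=> 0) l s.
  rewrite nth_cat; case: ltnP => // ls_s.
  by rewrite nth_nseq if_same nth_default.
have ls'N : (size ls' < N)%N by rewrite eqsz.
have := mA (Tuple (szpad _ lsN)) (Tuple (szpad _ ls'N))
  (Ordinal (ltn_trans tls lsN)) i.
have takepad l : take (size l) (pad l) = l by rewrite take_size_cat.
have takepad' : take (size ls) (pad ls') = ls' by rewrite -eqsz takepad.
move=> /(_ _ _ (size ls)) /=; rewrite takepad takepad'; apply.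
- by move=> s j sj; rewrite !(tnth_nth (fun=> 0)) /= !nthpad eqls.
- by rewrite !(tnth_nth (fun=> 0)) /= !nthpad.
- by rewrite tls.
Qed.

Lemma tree_swap_dist (base : base_alg R k) c M d (ls : seq (vec R k)) :
  (forall c N ls, is_dist (base c N ls)) -> (0 < d)%N ->
  is_dist (tree_swap base c M d ls).
Proof.
move=> base_dist d_gt0; split => [i|].
  rewrite /tree_swap mulr_ge0 ?invr_ge0 ?ler0n // sumr_ge0 // => h _.
  by rewrite /level_dist; apply (base_dist _ _ _).1.
rewrite -mulr_sumr exchange_big /=.
under eq_bigr => h _ do rewrite (base_dist _ _ _).2.
by rewrite sumr_const_nat subn1 /= mulVf // pnatr_eq0 -lt0n.
Qed.

(* Modifying round [t] modifies at most one of the block averages received by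
   an instance of the base algorithm, namely that of block
   [(t - start) %/ len]. *)
Lemma level_dist_monotone (base : base_alg R k) c M d (ls ls' : seq (vec R k))
    (t : nat) (i : 'I_k) h :
  (0 < M)%N -> fi_monotone M (base c M) ->
  size ls' = size ls ->
  (forall s j, (s, j) != (t, i) ->
     nth (fun=> 0) ls' s j = nth (fun=> 0) ls s j) ->
  nth (fun=> 0) ls' t i <= nth (fun=> 0) ls t i ->
  level_dist base c M d ls h i <= level_dist base c M d ls' h i.
Proof.
move=> M_gt0 mbase eqsz eqls le_t; rewrite /level_dist eqsz.
set n := size ls; set len := (M ^ (d - h))%N.
set st := node_start _ _ _; set D := digit _ _ _ _.
have len_gt0 : (0 < len)%N by rewrite expn_gt0 M_gt0.
have DM : (D < M)%N by rewrite ltn_mod.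
(* If [t < st], the truncated subtraction gives block 0. No block then contains round [t], and the
   two facts below still hold. *)
pose b := ((t - st) %/ len)%N.
have avg_eq b' j : (b', j) != (b, i) ->
    block_average ls' (st + b' * len) len j =
    block_average ls (st + b' * len) len j.
  move=> b'j; rewrite /block_average; congr (_ / _).
  apply: eq_bigr => u _; apply: eqls; apply: contra b'j.
  rewrite !xpair_eqE /b => /andP[/eqP <- ->]; rewrite andbT.
  by rewrite -addnA addKn divnMDl // divn_small ?addn0.
have avg_le : block_average ls' (st + b * len) len i <=
    block_average ls (st + b * len) len i.
  rewrite ler_wpM2r ?invr_ge0 ?ler0n //; apply: ler_sum => u _.
  have [->|ne] := eqVneq (st + b * len + u)%N t; first exact: le_t.
  by rewrite eqls // xpair_eqE negb_and ne.
(* If [D <= b], the modified block is not among the completed ones and the instance receives the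
   same inputs. Otherwise the base algorithm sees one lowered entry, in its own round [b]. *)
have [bD|Db] := ltnP b D; last first.
  rewrite le_eqVlt; apply/orP; left; apply/eqP; congr (base _ _ _ _).
  apply/eq_in_map => b'; rewrite mem_iota add0n => /andP[_ b'D].
  apply/funext => j; rewrite avg_eq // xpair_eqE negb_and neq_ltn.
  by rewrite (leq_trans b'D Db).
apply: (fi_monotone_seq (N := M) (t := b)) => //.
- by rewrite !size_map.
- by rewrite size_map size_iota bD.
- move=> s j sj; have [sD|Ds] := ltnP s D.
    by rewrite !(nth_map 0%N) ?size_iota // nth_iota // add0n avg_eq.
  by rewrite !nth_default // size_map size_iota.
- by rewrite !(nth_map 0%N) ?size_iota // nth_iota // add0n avg_le.
Qed.

Lemma tree_swap_monotone (base : base_alg R k) c M d (ls ls' : seq (vec R k))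
    (t : nat) (i : 'I_k) :
  (0 < M)%N -> fi_monotone M (base c M) ->
  size ls' = size ls ->
  (forall s j, (s, j) != (t, i) ->
     nth (fun=> 0) ls' s j = nth (fun=> 0) ls s j) ->
  nth (fun=> 0) ls' t i <= nth (fun=> 0) ls t i ->
  tree_swap base c M d ls i <= tree_swap base c M d ls' i.
Proof.
move=> M_gt0 mbase eqsz eqls le_t.
rewrite ler_wpM2l ?invr_ge0 ?ler0n //; apply: ler_sum => h _.
exact: (level_dist_monotone _ _ M_gt0 mbase eqsz eqls le_t).
Qed.

End TreeSwap.

(** * Expectations over the finite tree of random bits *)

Section AdaptiveMean.
Context {R : realType} {k : nat}.
Implicit Types (q : seq (option 'I_k * 'I_k) -> vec R k) (eps : R).

(** Every round has both a coin and a draw, even when it explores. Given the past they are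
    independent, hence the product. *)
Definition step_prob eps q (h : seq (option 'I_k * 'I_k))
    (x : option 'I_k * 'I_k) : R :=
  coin_prob eps x.1 * q h x.2.

(** The conditional expectation of [G] after [n] more rounds, given the past bits [h]. Defined by
    recursion on the tree, it makes conditioning on the past a matter of unfolding. *)
Fixpoint adaptive_mean eps q n (h : seq (option 'I_k * 'I_k))
    (G : seq (option 'I_k * 'I_k) -> R) : R :=
  if n is n'.+1 then
    \sum_x step_prob eps q h x * adaptive_mean eps q n' (rcons h x) G
  else G h.

Lemma sum_step_prob eps q h (F : option 'I_k * 'I_k -> R) :
  \sum_x step_prob eps q h x * F x =
  (1 - eps) * (\sum_j q h j * F (None, j)) +
  eps / k%:R * (\sum_e \sum_j q h j * F (Some e, j)).
Proof.
transitivity (\sum_e \sum_j coin_prob eps e * (q h j * F (e, j))).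
  by rewrite pair_bigA /=; apply: eq_bigr => -[e j] _; rewrite mulrA.
under eq_bigr => e _ do rewrite -mulr_sumr.
rewrite (bigD1 None) //=; congr (_ + _).
rewrite mulr_sumr (reindex_omap (Some : 'I_k -> _) id) /=; last by case.
by apply: eq_bigl => e; rewrite eqxx.
Qed.

Lemma step_prob_ge0 eps q h x :
  0 <= eps <= 1 -> is_dist (q h) -> 0 <= step_prob eps q h x.
Proof.
move=> /andP[e0 e1] [q_ge0 _]; apply: mulr_ge0 => //.
by case: x.1 => [e|] /=; rewrite ?divr_ge0 ?ler0n ?subr_ge0.
Qed.

Lemma sum_step_prob_1 eps q h :
  (0 < k)%N -> is_dist (q h) -> \sum_x step_prob eps q h x = 1.
Proof.
move=> hk [_ q1]; rewrite -[LHS]mulr1 mulr_suml sum_step_prob -mulr_suml q1.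
rewrite !mulr1 sumr_const card_ord divfK ?subrK //.
by rewrite pnatr_eq0 -lt0n.
Qed.

(** Path-by-path form, in which the product law of [mono_bandit_randomness] can be recognized. *)
Lemma adaptive_mean_tupleE eps q n h G :
  adaptive_mean eps q n h G =
  \sum_(b : n.-tuple (option 'I_k * 'I_k))
     (\prod_(t < n) step_prob eps q (h ++ take t b) (tnth b t)) * G (h ++ b).
Proof.
elim: n h => [|n IH] h /=.
  rewrite (big_pred1 [tuple]) => [|b]; last by rewrite [b]tuple0; apply/esym/eqP.
  by rewrite big_ord0 mul1r cats0.
rewrite (reindex (fun p : _ * n.-tuple _ => cons_tuple p.1 p.2)) /=; last first.
  exists (fun b => (thead b, behead_tuple b)) => [[x b] _|b _] /=.
    by congr (_, _); apply: val_inj.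
  by rewrite /= [RHS]tuple_eta; apply: val_inj.
rewrite -(pair_bigA _ (fun x (b : n.-tuple _) =>
  (\prod_(t < n.+1) step_prob eps q (h ++ take t (x :: b))
     (tnth (cons_tuple x b) t)) * G (h ++ x :: b))) /=.
apply: eq_bigr => x _; rewrite IH mulr_sumr; apply: eq_bigr => b _.
rewrite big_ord_recl /= cats0 tnth0 cat_rcons -mulrA; congr (_ * (_ * _)).
apply: eq_bigr => t _; rewrite tnthS; congr step_prob.
by rewrite /= cat_rcons.
Qed.

Lemma adaptive_mean_cat eps q m n h G :
  adaptive_mean eps q (m + n) h G =
  adaptive_mean eps q m h (fun h' => adaptive_mean eps q n h' G).
Proof.
by elim: m h => //= m IH h; apply: eq_bigr => x _; rewrite IH.
Qed.

(** Step probabilities sum to 1, so rounds that [G] ignores average out. *)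
Lemma adaptive_mean_stable eps q n h G :
  (0 < k)%N -> (forall h', is_dist (q h')) -> (forall s, G (h ++ s) = G h) ->
  adaptive_mean eps q n h G = G h.
Proof.
move=> hk dq; elim: n h => //= n IH h Gh.
have Gr x : G (rcons h x) = G h by rewrite -cats1.
under eq_bigr => x _.
  rewrite IH => [|s]; last by rewrite cat_rcons !Gh Gr.
  rewrite Gr; over.
by rewrite -mulr_suml sum_step_prob_1 // mul1r.
Qed.

(** Backward induction along the tree: [Phi] dominates [G] at the leaves, and averaging over one
    round keeps it below its value at the parent. *)
Lemma adaptive_mean_supermartingale eps q n h G (Phi : _ -> R) :
  0 <= eps <= 1 -> (forall h', is_dist (q h')) ->
  (forall h', (size h' < size h + n)%N ->
     \sum_x step_prob eps q h' x * Phi (rcons h' x) <= Phi h') ->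
  (forall h', size h' = (size h + n)%N -> G h' <= Phi h') ->
  adaptive_mean eps q n h G <= Phi h.
Proof.
move=> eps01 dq; elim: n h => [|n IH] h step final /=.
  by rewrite final ?addn0.
apply: le_trans (step h _); last by rewrite addnS ltnS leq_addr.
apply: ler_sum => x _; rewrite ler_wpM2l ?step_prob_ge0 //.
by apply: IH => h'; rewrite size_rcons addSnnS; [apply: step|apply: final].
Qed.

(** The recursion consults the distributions only on histories shorter than the final ones. Hence
    final values can be compared history by history even if [q] and [q'] differ from then on. *)
Lemma adaptive_mean_le eps q q' n h G G' :
  0 <= eps <= 1 -> (forall h', is_dist (q h')) ->
  (forall h', (size h' < size h + n)%N -> q' h' = q h') ->
  (forall h', size h' = (size h + n)%N -> G h' <= G' h') ->
  adaptive_mean eps q n h G <= adaptive_mean eps q' n h G'.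
Proof.
move=> eps01 dq; elim: n h => [|n IH] h eqq leG /=.
  by rewrite leG ?addn0.
apply: ler_sum => x _; rewrite /step_prob eqq ?addnS ?ltnS ?leq_addr //.
rewrite ler_wpM2l ?step_prob_ge0 //.
by apply: IH => h'; rewrite size_rcons addSnnS; [apply: eqq|apply: leG].
Qed.

End AdaptiveMean.

(** * The law of bits whose distributions depend on earlier bits *)

Section AdaptiveLaw.
Context {R : realType} {k : nat} {disp : measure_display}.
Context {Omega : measurableType disp}.
Variables (P : probability Omega R) (T : nat) (eps : R).
Variables (coin : coinT k Omega) (draw : drawT R k Omega).
Variable q : seq (option 'I_k * 'I_k) -> vec R k.

Fixpoint adaptive_bits (t : nat) (w : Omega) : seq (option 'I_k * 'I_k) :=
  if t is t'.+1 then
    let h := adaptive_bits t' w in rcons h (coin t' w, draw t' (q h) w)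
  else [::].

Lemma size_adaptive_bits t w : size (adaptive_bits t w) = t.
Proof. by elim: t => //= t IH; rewrite size_rcons IH. Qed.

Lemma adaptive_bits_cat t s w :
  exists u, adaptive_bits (t + s) w = adaptive_bits t w ++ u.
Proof.
elim: s => [|s [u IH]]; first by exists [::]; rewrite addn0 cats0.
by rewrite addnS /= IH rcons_cat; eexists.
Qed.

Lemma adaptive_bits_take t n w :
  (t <= n)%N -> adaptive_bits t w = take t (adaptive_bits n w).
Proof.
move=> tn; have [u] := adaptive_bits_cat t (n - t) w.
by rewrite subnKC // => ->; rewrite take_size_cat // size_adaptive_bits.
Qed.

Lemma nth_adaptive_bits n w t x0 : (t < n)%N ->
  nth x0 (adaptive_bits n w) t =
  (coin t w, draw t (q (adaptive_bits t w)) w).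
Proof.
move=> tn; rewrite -(@nth_take t.+1) // -adaptive_bits_take //=.
by rewrite nth_rcons size_adaptive_bits ltnn eqxx.
Qed.

(** Once the path [b] is prescribed, the distribution of each round is the fixed [q (take t b)].
    This turns an adaptive choice into one distribution per round, the case covered by the law of
    the randomness. *)
Lemma adaptive_bits_event n (b : n.-tuple (option 'I_k * 'I_k)) :
  [set w | adaptive_bits n w = b] =
  [set w | forall t : 'I_n, coin t w = (tnth b t).1 /\
                            draw t (q (take t b)) w = (tnth b t).2].
Proof.
apply/seteqP; split => w /= bw.
  move=> t; have x0 := tnth b t.
  have := nth_adaptive_bits w x0 (ltn_ord t).
  by rewrite (adaptive_bits_take w (ltnW (ltn_ord t))) bw -tnth_nth => ->.
(* Conversely, agreement with [b] propagates round by round, since the distribution of a round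
   depends only on the bits before it. *)
have pre t : (t <= n)%N -> adaptive_bits t w = take t b.
  elim: t => [|t IH] tn; first by rewrite take0.
  have [c d] := bw (Ordinal tn); rewrite /= in c d.
  have x0 := tnth b (Ordinal tn).
  rewrite (take_nth x0) ?size_tuple //= IH 1?ltnW // c d.
  by rewrite (tnth_nth x0) -surjective_pairing.
by rewrite pre // take_oversize // size_tuple.
Qed.

Hypothesis randomness : mono_bandit_randomness P T eps coin draw.
Hypothesis q_dist : forall h, is_dist (q h).

Lemma measurable_adaptive_bits n (b : n.-tuple (option 'I_k * 'I_k)) :
  measurable [set w | adaptive_bits n w = b].
Proof.
case: randomness => mcoin mdraw _; rewrite adaptive_bits_event.
rewrite (_ : [set w | _] = \bigcap_(t in [set: 'I_n])
    ([set w | coin t w = (tnth b t).1] `&`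
     [set w | draw t (q (take t b)) w = (tnth b t).2])).
  apply: fin_bigcap_measurable => // t _.
  by apply: measurableI; [apply: mcoin|apply: mdraw].
by apply/seteqP; split => [w bw t _|w bw t]; apply: bw.
Qed.

(** The bits take finitely many values, so the integrand is a finite combination of indicators of
    events with known probability. *)
Lemma expectation_adaptive_bits (G : seq (option 'I_k * 'I_k) -> R) :
  ('E_P[fun w => G (adaptive_bits T w)] = (adaptive_mean eps q T [::] G)%:E)%E.
Proof.
pose E (b : T.-tuple (option 'I_k * 'I_k)) := [set w | adaptive_bits T w = b].
have mE b : measurable (E b) by exact: measurable_adaptive_bits.
have iE b : P.-integrable [set: Omega] (fun w => (\1_(E b) w)%:E).
  exact: integrable_indic.
have -> : (fun w => G (adaptive_bits T w)) = 
      (fun w => \sum_(b : T.-tuple (option 'I_k * 'I_k)) G b * \1_(E b) w).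
  apply/funext => w.
  have szb : size (adaptive_bits T w) == T by rewrite size_adaptive_bits.
  rewrite (bigD1 (Tuple szb)) //= big1 ?addr0 => [|b neb].
    by rewrite indicE mem_set ?mulr1.
  rewrite indicE memNset ?mulr0 // => /= eb; case/eqP: neb.
  exact/val_inj.
rewrite unlock; under eq_integral => w _.
  rewrite -sumEFin; under eq_bigr do rewrite EFinM; over.
rewrite integral_sum //=; last by move=> b; apply: integrableZl.
rewrite adaptive_mean_tupleE -sumEFin; apply: eq_bigr => b _.
rewrite integralZl // integral_indic // setIT [in RHS]mulrC EFinM; congr (_ * _)%E.
rewrite /E adaptive_bits_event.
case: randomness => _ _ law.
exact: (law (fun t => q (take t b)) (fun t => (tnth b t).1)
  (fun t => (tnth b t).2)).
Qed.

Lemma probability_adaptive_bits (S : pred (seq (option 'I_k * 'I_k))) :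
  P [set w | S (adaptive_bits T w)] =
  (adaptive_mean eps q T [::] (fun h => (S h)%:R))%:E.
Proof.
rewrite -expectation_adaptive_bits.
rewrite (_ : (fun w => _) = \1_[set w | S (adaptive_bits T w)]); last first.
  apply/funext => w; rewrite indicE; congr (_%:R); congr nat_of_bool.
  by apply/idP/idP => [Sw|/set_mem//]; exact/mem_set.
rewrite expectation_indic //.
rewrite (_ : [set w | _] = \bigcup_(b in [set b : T.-tuple _ | S b])
    [set w | adaptive_bits T w = b]).
  by apply: fin_bigcup_measurable => // b _; apply: measurable_adaptive_bits.
apply/seteqP; split => [w Sw|w [b Sb /= ->] //].
have szb : size (adaptive_bits T w) == T by rewrite size_adaptive_bits.
by exists (Tuple szb).
Qed.

End AdaptiveLaw.

(** * Monotonicity of MonoBandit *)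

Section MonoBandit.
Context {R : realType} {k : nat} {disp : measure_display}.
Context {Omega : measurableType disp}.

Definition bits_action (x : option 'I_k * 'I_k) : 'I_k :=
  if x.1 is Some j then j else x.2.

(** Reads the coins off a sequence of bits instead of the outcome, so that the fed vectors become a
    function on the tree of bits. *)
Definition fed_along (eps : R) (b : seq (option 'I_k * 'I_k))
    (pi : ptranscript R k) : seq (vec R k) :=
  [seq fed_vector eps x.1 x.2 | x <- zip (unzip1 b) pi].

Lemma size_fed_along eps b pi :
  size b = size pi -> size (fed_along eps b pi) = size pi.
Proof. by move=> e; rewrite size_map size_zip size_map e minnn. Qed.

Lemma nth_fed_along eps b pi x0 y0 s :
  size b = size pi -> (s < size pi)%N ->
  nth (fun=> 0) (fed_along eps b pi) s =
  fed_vector eps (nth x0 b s).1 (nth y0 pi s).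
Proof.
move=> e spi; rewrite (nth_map (x0.1, y0)); last first.
  by rewrite size_zip size_map e minnn.
by rewrite nth_zip ?size_map // (nth_map x0) ?e.
Qed.

(** Only the coins of the bits enter, so this holds for every [q]. *)
Lemma fed_vectorsE eps (coin : coinT k Omega) draw q pi w :
  fed_vectors eps coin pi w =
  fed_along eps (adaptive_bits (R := R) coin draw q (size pi) w) pi.
Proof.
have coins t : unzip1 (adaptive_bits coin draw q t w) =
    [seq coin s w | s <- iota 0 t].
  elim: t => [//|t IH]; rewrite -[X in iota 0 X]addn1 iotaD map_cat -IH.
  by rewrite cats1 /unzip1 /= map_rcons.
rewrite /fed_along coins /fed_vectors.
move: (iota 0 (size pi)) => r.
by elim: r pi => [|s r IH] [|x pi] //=; rewrite IH.
Qed.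

Lemma unif_dist : (0 < k)%N -> is_dist ((fun=> k%:R^-1) : vec R k).
Proof.
move=> hk; split=> [i|]; first by rewrite invr_ge0 ler0n.
by rewrite sumr_const card_ord -(mulr_natr k%:R^-1) mulVf // pnatr_eq0 -lt0n.
Qed.

(** The observed loss is placed at the action selected in the transcript. With the coins fixed, only
    the entry [i] of round [t] can move, and it moves down because returns are negated losses. *)
Lemma fed_along_lower eps b pi pi' (t s : nat) (i j : 'I_k) r r' y0 :
  (0 < eps) -> size b = size pi -> size pi' = size pi -> (t < size pi)%N ->
  (forall s, s != t -> nth y0 pi' s = nth y0 pi s) ->
  nth y0 pi t = (i, r) -> nth y0 pi' t = (i, r') -> r <= r' ->
  ((s, j) != (t, i) -> nth (fun=> 0) (fed_along eps b pi') s j =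
                       nth (fun=> 0) (fed_along eps b pi) s j) /\
  nth (fun=> 0) (fed_along eps b pi') t i <=
  nth (fun=> 0) (fed_along eps b pi) t i.
Proof.
move=> eps0 szb szpi tpi eqpi pit pi't rr'.
have x0 : option 'I_k * 'I_k := (None, i).
split => [sj|].
  have [spi|pis] := ltnP s (size pi); last first.
    by rewrite !nth_default // ?size_fed_along ?szpi.
  rewrite !(nth_fed_along _ x0 y0) ?szpi //.
  have [st|st] := eqVneq s t; last by rewrite eqpi.
  have /negPf ji : j != i by move: sj; rewrite xpair_eqE st eqxx.
  by rewrite st pit pi't /fed_vector /= ji andbF.
rewrite !(nth_fed_along _ x0 y0) ?szpi // pit pi't /fed_vector /= eqxx andbT.
case: isSome => //; rewrite ler_wpM2r ?invr_ge0 ?(ltW eps0) //.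
by rewrite ler_wpM2l ?ler0n // lerN2.
Qed.

(** Later rounds average out; in the round after [h], the action [i] comes from the draw when
    exploiting or from the coin when exploring. *)
Lemma adaptive_mean_last_action eps q n h i :
  (0 < k)%N -> (forall h', is_dist (q h')) ->
  adaptive_mean eps q n.+1 h
    (fun h' => (bits_action (nth (None, i) h' (size h)) == i)%:R : R) =
  (1 - eps) * q h i + eps / k%:R.
Proof.
move=> hk dq /=.
transitivity (\sum_x step_prob eps q h x * (bits_action x == i)%:R).
  apply: eq_bigr => x _; rewrite adaptive_mean_stable // => [|s].
    by rewrite nth_rcons ltnn eqxx.
  by rewrite nth_cat size_rcons ltnSn.
have ind (f : 'I_k -> R) : \sum_j f j * (j == i)%:R = f i.
  by rewrite (bigD1 i) //= eqxx mulr1 big1 ?addr0 // => j /negPf ->; rewrite mulr0.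
rewrite sum_step_prob ind; congr (_ + _); rewrite -[RHS]mulr1; congr (_ * _).
under eq_bigr => e _ do rewrite -mulr_suml (dq h).2.
exact: ind.
Qed.

(** The two transcripts are compared path by path: given the same coins in the first [n] rounds, [i]
    is selected with probability [(1 - eps) * A _ i + eps / k], where only the vectors fed to [A]
    differ. *)
Lemma mono_bandit_monotone (P : probability Omega R) T (A : fi_alg R k) eps
    (coin : coinT k Omega) draw :
  (0 < k)%N -> 0 < eps <= 1 -> (forall ls, is_dist (A ls)) ->
  (forall (ls ls' : seq (vec R k)) (t : nat) (i : 'I_k), size ls' = size ls ->
     (forall s j, (s, j) != (t, i) ->
        nth (fun=> 0) ls' s j = nth (fun=> 0) ls s j) ->
     nth (fun=> 0) ls' t i <= nth (fun=> 0) ls t i -> A ls i <= A ls' i) ->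
  mono_bandit_randomness P T eps coin draw ->
  monotone_mechanism P T (mono_bandit A eps coin draw).
Proof.
move=> hk /andP[eps0 eps1] dA mA rnd pi pi' t i r r' eqpi pit pi't rr' n.
move=> /andP[tn nT].
have eps01 : 0 <= eps <= 1 by rewrite ltW.
(* On a prescribed transcript only the draw of round [n] affects the action chosen there. The
   uniform distribution in the other rounds makes the law of the first [n] rounds independent of
   [rho]. *)
pose q (rho : seq ('I_k * R)) (h : seq (option 'I_k * 'I_k)) : vec R k :=
  if size h == n then A (fed_along eps h rho) else fun=> k%:R^-1.
have dq rho h : is_dist (q rho h).
  by rewrite /q; case: eqP => _; [apply: dA|apply: unif_dist].
pose G (h : seq (option 'I_k * 'I_k)) : R :=
  (bits_action (nth (None, i) h n) == i)%:R.
have probE rho : size rho = n ->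
    P [set w | mono_bandit A eps coin draw rho w = i] =
    (adaptive_mean eps (q rho) T [::] G)%:E.
  move=> szrho.
  rewrite -(probability_adaptive_bits rnd (dq rho)
     (fun h => bits_action (nth (None, i) h n) == i)).
  congr (P _); apply/funext => w; apply/propext.
  rewrite /= nth_adaptive_bits // /mono_bandit /mono_bandit_bits /bits_action /=.
  have -> : q rho (adaptive_bits coin draw (q rho) n w) =
      current_dist A eps coin rho w.
    rewrite /q size_adaptive_bits eqxx -{2}szrho -fed_vectorsE.
    (* Since [t < n], the transcript is nonempty and the uniform start is excluded. *)
    by case: rho szrho => // n0; move: tn; rewrite -n0.
  by rewrite szrho; case: (coin n w) => [e|]; split=> /eqP.
have szn (rho : T.-tuple ('I_k * R)) : size (take n rho) = n.
  by rewrite size_takel // size_tuple ltnW.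
have meanT rho : adaptive_mean eps (q rho) T [::] G = adaptive_mean eps (q rho)
    n [::] (fun h => adaptive_mean eps (q rho) (T - n.+1).+1 h G).
  by rewrite -adaptive_mean_cat addnS -addSn subnKC.
rewrite !probE // lee_fin !meanT.
apply: adaptive_mean_le => // h szh; rewrite add0n in szh.
  by rewrite /q ltn_eqF.
rewrite /G -szh !adaptive_mean_last_action // lerD2r ler_wpM2l ?subr_ge0 //.
rewrite /q szh eqxx.
have nth_take' (rho : T.-tuple ('I_k * R)) (s : 'I_T) : (s < n)%N ->
    nth (i, r) (take n rho) s = tnth rho s.
  by move=> sn; rewrite nth_take // -tnth_nth.
have eqn s : s != t :> nat ->
    nth (i, r) (take n pi') s = nth (i, r) (take n pi) s.
  move=> st; have [sn|ns] := ltnP s n; last by rewrite !nth_default ?szn.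
  by rewrite !(nth_take' _ (Ordinal (ltn_trans sn nT))) // eqpi.
have low s j := @fed_along_lower eps h (take n pi) (take n pi') t s i j r r'
  (i, r) eps0.
apply: (mA _ _ t); first by rewrite !size_fed_along ?szn.
  by move=> s j; apply: (low s j _ _ _ eqn _ _ rr').1;
     rewrite ?szn // nth_take'.
by apply: (low 0%N i _ _ _ eqn _ _ rr').2; rewrite ?szn // nth_take'.
Qed.

End MonoBandit.

(** * Swap regret of MonoBandit against an adaptive adversary *)

Section Regret.
Context {R : realType} {k : nat} {disp : measure_display}.
Context {Omega : measurableType disp}.
Implicit Types (adv : adversary R k (option 'I_k * 'I_k)) (eps : R).
Implicit Types (b : seq (option 'I_k * 'I_k)) (A : fi_alg R k).

(** Replays the interaction from the bits alone, which is possible because the adversary is a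
    deterministic function of the record. *)
Definition play adv b : seq (round_record (option 'I_k * 'I_k)) :=
  foldl (fun h x => rcons h (RoundRecord (adv h) (bits_action x) x)) [::] b.

Lemma play_rcons adv b x :
  play adv (rcons b x) =
  rcons (play adv b) (RoundRecord (adv (play adv b)) (bits_action x) x).
Proof. by rewrite /play foldl_rcons. Qed.

Definition play_view adv b : ptranscript R k := principal_view (play adv b).

Lemma play_view_rcons adv b x :
  play_view adv (rcons b x) =
  rcons (play_view adv b)
    (bits_action x, - adv (play adv b) (bits_action x)).
Proof. by rewrite /play_view play_rcons /principal_view map_rcons. Qed.

Lemma size_play_view adv b : size (play_view adv b) = size b.
Proof.
elim/last_ind: b => // b x IH.
by rewrite play_view_rcons !size_rcons IH.
Qed.

Definition play_fed eps adv b : seq (vec R k) :=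
  fed_along eps b (play_view adv b).

Lemma play_fed_rcons eps adv b x :
  play_fed eps adv (rcons b x) =
  rcons (play_fed eps adv b)
    (fed_vector eps x.1
       (bits_action x, - adv (play adv b) (bits_action x))).
Proof.
rewrite /play_fed play_view_rcons /fed_along /unzip1 map_rcons zip_rcons.
  by rewrite map_rcons.
by rewrite size_map size_play_view.
Qed.

Lemma size_play_fed eps adv b : size (play_fed eps adv b) = size b.
Proof. by rewrite size_fed_along size_play_view. Qed.

Definition play_dist A eps adv b : vec R k :=
  if b is [::] then fun=> k%:R^-1 else A (play_fed eps adv b).

(** Moves the regret from the probability space to the tree of bits. *)
Lemma mono_bandit_interaction A eps (coin : coinT k Omega) draw adv t w :
  interaction (mono_bandit A eps coin draw) (mono_bandit_bits A eps coin draw)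
    adv t w =
  play adv (adaptive_bits coin draw (play_dist A eps adv) t w).
Proof.
elim: t => //= t IH; rewrite play_rcons IH.
set b := adaptive_bits _ _ _ t w.
have szb : size (principal_view (play adv b)) = t.
  by rewrite (size_play_view adv b) size_adaptive_bits.
have bitsE : mono_bandit_bits A eps coin draw (principal_view (play adv b)) w =
    (coin t w, draw t (play_dist A eps adv b) w).
  rewrite /mono_bandit_bits szb; congr (_, draw _ _ _).
  rewrite /current_dist (fed_vectorsE _ _ draw (play_dist A eps adv)) szb -/b.
  rewrite /play_dist /play_fed.
  have := size_play_view adv b; rewrite -/(play_view adv b).
  by case: b (play_view adv b) {szb} => [|? ?] [|? ?].
by rewrite /mono_bandit bitsE.
Qed.

Lemma play_fed_bounds eps adv b s i :
  0 < eps -> (forall h i, 0 <= adv h i <= 1) ->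
  0 <= nth (fun=> 0) (play_fed eps adv b) s i <= 0 + k%:R / eps.
Proof.
move=> eps0 adv01; rewrite add0r.
have ke0 : 0 <= k%:R / eps by rewrite divr_ge0 ?ler0n // ltW.
elim/last_ind: b => [|b x IH]; first by rewrite nth_default ?lexx.
rewrite play_fed_rcons nth_rcons; case: ltnP => // _.
case: eqP => _; last by rewrite lexx.
rewrite /fed_vector /=; case: ifP => _; last by rewrite lexx.
have /andP[l0 l1] := adv01 (play adv b) (bits_action x).
rewrite opprK mulrAC mulr_ge0 //=.
by rewrite -[leRHS]mulr1 ler_wpM2l.
Qed.

(** Stated for sequences and a fixed [chi], so that it can grow by one round at a time. *)
Definition fed_regret A (chi : 'I_k -> 'I_k) (vs : seq (vec R k)) : R :=
  \sum_(t < size vs) \sum_j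
     A (take t vs) j * (nth (fun=> 0) vs t j - nth (fun=> 0) vs t (chi j)).

Lemma fed_regret_rcons A chi vs v :
  fed_regret A chi (rcons vs v) =
  fed_regret A chi vs + \sum_j A vs j * (v j - v (chi j)).
Proof.
rewrite /fed_regret size_rcons big_ord_recr /=; congr (_ + _).
  apply: eq_bigr => t _; apply: eq_bigr => j _.
  by rewrite nth_rcons ltn_ord -cats1 take_cat ltn_ord.
apply: eq_bigr => j _.
by rewrite nth_rcons ltnn eqxx -cats1 take_size_cat.
Qed.

Lemma fed_regret_le A (chi : {ffun 'I_k -> 'I_k}) T (ls : T.-tuple (vec R k)) :
  fed_regret A chi ls <= fi_swap_regret A ls.
Proof.
rewrite /fed_regret size_tuple.
under eq_bigr => t _ do under eq_bigr => j _ do rewrite -tnth_nth.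
exact: (le_bigmax _ (fun chi : {ffun 'I_k -> 'I_k} => \sum_(t < T) \sum_j
  A (take t ls) j * (tnth ls t j - tnth ls t (chi j))) chi).
Qed.

Lemma dist_mean_le (p : vec R k) (g : 'I_k -> R) c :
  is_dist p -> (forall j, g j <= c) -> \sum_j p j * g j <= c.
Proof.
move=> [p0 p1] gc; rewrite -[leRHS]mul1r -p1 mulr_suml.
by apply: ler_sum => j _; apply: ler_wpM2l.
Qed.

(* The fed vector is an unbiased estimate of the loss vector, so conditionally
   on the past the fed regret grows by the regret of [A] on the true losses,
   while the realized regret differs from it only in exploration rounds and in
   the first round, where the actual distribution is uniform. *)
Lemma one_round_regret eps (a : vec R k) q b (l : vec R k)
    (chi : 'I_k -> 'I_k) :
  (0 < k)%N -> 0 < eps <= 1 -> is_dist (q b) -> is_dist a ->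
  (forall i, 0 <= l i <= 1) ->
  \sum_x step_prob eps q b x *
    (l (bits_action x) - l (chi (bits_action x)) -
     (1 - eps) * \sum_j a j *
        (fed_vector eps x.1 (bits_action x, - l (bits_action x)) j -
         fed_vector eps x.1 (bits_action x, - l (bits_action x)) (chi j)))
  <= eps + (1 - eps) * \sum_j (q b j - a j) * (l j - l (chi j)).
Proof.
move=> hk /andP[eps0 eps1] dq da l01.
have k0 : k%:R != 0 :> R by rewrite pnatr_eq0 -lt0n.
(* Action [i] is explored with probability [eps / k] and then contributes [k * l i / eps]. *)
have unbiased i : eps / k%:R * (\sum_e fed_vector eps (Some e) (e, - l e) i) = l i.
  rewrite (bigD1 i) //= /fed_vector /= eqxx big1 => [|e /negPf ie].
    by rewrite addr0 opprK; field; rewrite k0 gt_eqF.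
  by rewrite eq_sym ie.
have g1 j : l j - l (chi j) <= 1.
  by have := l01 j; have := l01 (chi j); move=> /andP[? ?] /andP[? ?]; lra.
pose g j := l j - l (chi j).
pose v e : vec R k := fed_vector eps (Some e) (e, - l e).
pose F (x : option 'I_k * 'I_k) :=
  g (bits_action x) - (1 - eps) * \sum_j a j *
    (fed_vector eps x.1 (bits_action x, - l (bits_action x)) j -
     fed_vector eps x.1 (bits_action x, - l (bits_action x)) (chi j)).
have FN j : F (None, j) = g j.
  rewrite /F big1 ?mulr0 ?subr0 // => j' _.
  by rewrite /fed_vector /= subrr mulr0.
have FS e j : F (Some e, j) =
    g e - (1 - eps) * \sum_j a j * (v e j - v e (chi j)) by [].
rewrite (sum_step_prob eps q b F).
have -> : \sum_e \sum_j q b j * F (Some e, j) = \sum_e g e -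
    (1 - eps) * \sum_j a j * (\sum_e v e j - \sum_e v e (chi j)).
  transitivity (\sum_e (g e - (1 - eps) * \sum_j a j * (v e j - v e (chi j)))).
    apply: eq_bigr => e _; under eq_bigr => j _ do rewrite FS.
    by rewrite -mulr_suml dq.2 mul1r.
  rewrite big_split /= sumrN -mulr_sumr exchange_big /=.
  congr (_ - _ * _); apply: eq_bigr => j _.
  by rewrite -mulr_sumr big_split /= sumrN.
have -> : eps / k%:R * (\sum_e g e -
    (1 - eps) * \sum_j a j * (\sum_e v e j - \sum_e v e (chi j))) =
    eps / k%:R * (\sum_e g e) - (1 - eps) * \sum_j a j * g j.
  rewrite mulrBr; congr (_ - _); rewrite mulrCA mulr_sumr; congr (_ * _).
  by apply: eq_bigr => j _; rewrite mulrCA mulrBr !unbiased.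
under eq_bigr => j _ do rewrite FN.
have -> : \sum_j (q b j - a j) * (l j - l (chi j)) =
    \sum_j q b j * g j - \sum_j a j * g j.
  by rewrite -sumrN -big_split; apply: eq_bigr => j _; rewrite mulrBl.
(* The cost of exploring: [eps] times the uniform mean of [g], which is at most 1. *)
have : eps / k%:R * (\sum_e g e) <= eps.
  rewrite -[leRHS]mulr1 -mulrA ler_wpM2l ?(ltW eps0) // mulr_sumr.
  exact: (dist_mean_le (unif_dist hk)).
lra.
Qed.

Lemma mono_bandit_swap_regret (P : probability Omega R) T A eps (B : R)
    (coin : coinT k Omega) draw adv :
  (0 < k)%N -> 0 < eps <= 1 -> (forall ls, is_dist (A ls)) -> 0 <= B ->
  (forall ls : T.-tuple (vec R k), losses_in 0 (k%:R / eps) ls ->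
     fi_swap_regret A ls <= B) ->
  mono_bandit_randomness P T eps coin draw ->
  (forall h i, 0 <= adv h i <= 1) ->
  (swap_regret P (mono_bandit A eps coin draw)
     (mono_bandit_bits A eps coin draw) adv T
   <= (eps * T%:R + (1 - eps) * B + 2)%:E)%E.
Proof.
move=> hk eps01' dA B0 boundA rnd adv01.
have /andP[eps0 eps1] := eps01'.
have eps01 : 0 <= eps <= 1 by rewrite ltW.
have e1 : 0 <= 1 - eps by rewrite subr_ge0.
apply: bigmax_le => [|chi _].
  by rewrite lee_fin !addr_ge0 // mulr_ge0 // ?ler0n // ltW.
pose q := play_dist A eps adv.
have dq b : is_dist (q b) by case: b => *; [apply: unif_dist|apply: dA].
pose reg (h : seq (round_record (option 'I_k * 'I_k))) : R :=
  \sum_(x <- h) (rr_loss x (rr_action x) - rr_loss x (chi (rr_action x))).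
under eq_fun do rewrite mono_bandit_interaction.
rewrite (expectation_adaptive_bits rnd dq (fun b => reg (play adv b))) lee_fin.
(* The potential holds a budget of [eps] per remaining round, the bound on the final fed regret, and
   2 to be spent in the first round. *)
pose Phi b := reg (play adv b) - (1 - eps) * fed_regret A chi (play_fed eps adv b)
  + eps * (T%:R - (size b)%:R) + (1 - eps) * B + (nilp b)%:R * 2.
have -> : eps * T%:R + (1 - eps) * B + 2 = Phi [::].
  rewrite /Phi /reg /fed_regret /= big_nil big_ord0 /nilp /=; ring.
apply: adaptive_mean_supermartingale => // b; rewrite /= add0n => szb; last first.
  have szV : size (play_fed eps adv b) == T by rewrite size_play_fed szb.
  have le_B : fed_regret A chi (play_fed eps adv b) <= B.
    apply: le_trans (fed_regret_le A chi (Tuple szV)) _; apply: boundA => t i.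
    by rewrite (tnth_nth (fun=> 0)); apply: play_fed_bounds.
  rewrite /Phi szb subrr mulr0 addr0.
  have : (1 - eps) * fed_regret A chi (play_fed eps adv b) <= (1 - eps) * B.
    exact: ler_wpM2l.
  have : 0 <= (nilp b)%:R * 2 :> R by rewrite mulr_ge0.
  lra.
set l := adv (play adv b); set a := A (play_fed eps adv b).
pose F (x : option 'I_k * 'I_k) :=
  l (bits_action x) - l (chi (bits_action x)) -
  (1 - eps) * \sum_j a j *
     (fed_vector eps x.1 (bits_action x, - l (bits_action x)) j -
      fed_vector eps x.1 (bits_action x, - l (bits_action x)) (chi j)).
have PhiE x : Phi (rcons b x) = Phi b - eps - (nilp b)%:R * 2 + F x.
  rewrite /Phi /F /reg play_rcons play_fed_rcons fed_regret_rcons.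
  rewrite -cats1 big_cat big_seq1 /= -/l -/a size_rcons -natr1.
  have -> : nilp (rcons b x) = false by case: (b).
  rewrite mul0r.
  by ring.
under eq_bigr => x _ do rewrite PhiE mulrDr.
rewrite big_split /= -mulr_suml sum_step_prob_1 // mul1r.
have round : \sum_x step_prob eps q b x * F x <=
    eps + (1 - eps) * \sum_j (q b j - a j) * (l j - l (chi j)).
  by apply: one_round_regret => //; [exact: dA|exact: adv01].
suff : (1 - eps) * \sum_j (q b j - a j) * (l j - l (chi j)) <= (nilp b)%:R * 2.
  by move: round; lra.
(* After the first round [q b] and [a] coincide. In the first round both may differ, but each mean
   of [g] lies between -1 and 1, whence the 2. *)
rewrite /q /play_dist /a; case: (b) => [|x b'] /=; last first.
  by rewrite big1 ?mulr0 ?mul0r // => j _; rewrite subrr mul0r.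
pose g j := l j - l (chi j).
have g1 j : g j <= 1 /\ - g j <= 1.
  have := adv01 (play adv b) j; have := adv01 (play adv b) (chi j).
  by rewrite -/l /g => /andP[? ?] /andP[? ?]; split; lra.
set S := \sum_j _.
have S2 : S <= 2.
  have -> : S = \sum_j k%:R^-1 * g j + \sum_j A (play_fed eps adv [::]) j * - g j.
    by rewrite -big_split; apply: eq_bigr => j _ /=; rewrite mulrN -mulrBl.
  have := dist_mean_le (unif_dist hk) (fun j => (g1 j).1).
  have := dist_mean_le (dA (play_fed eps adv [::])) (fun j => (g1 j).2).
  lra.
have : (1 - eps) * S <= (1 - eps) * 2 by rewrite ler_wpM2l.
lra.
Qed.

End Regret.

(** * The exploration rate and the asymptotic bound *)

Lemma explore_rate_bounds {R : realType} k (SR : nat -> R) T :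
  (0 < k)%N -> (0 < T)%N -> 0 < SR T -> 0 < explore_rate k SR T <= 1.
Proof.
move=> hk hT SR0; rewrite /explore_rate lt_min ltr01 ge_min lexx /= andbT.
by rewrite sqrtr_gt0 divr_gt0 ?ltr0n // mulr_gt0 ?ltr0n.
Qed.

(* When the minimum defining the rate is attained at 1, every round explores,
   and the bound is just [T <= sqrt (k * SR T * T)]. *)
Lemma explore_rate_balance {R : realType} k (SR : nat -> R) T :
  (0 < k)%N -> (0 < T)%N -> 0 < SR T ->
  explore_rate k SR T * T%:R +
    (1 - explore_rate k SR T) * (k%:R / explore_rate k SR T * SR T) <=
  2 * Num.sqrt k%:R * Num.sqrt (SR T * T%:R).
Proof.
move=> hk hT SR0.
have k0 : 0 < k%:R :> R by rewrite ltr0n.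
have T0 : 0 < T%:R :> R by rewrite ltr0n.
pose x := Num.sqrt (k%:R * SR T / T%:R).
have x0 : 0 < x by rewrite sqrtr_gt0 divr_gt0 // mulr_gt0.
have xx : x ^+ 2 * T%:R = k%:R * SR T.
  by rewrite sqr_sqrtr ?divfK ?gt_eqF // divr_ge0 ?mulr_ge0 // ltW.
have -> : 2 * Num.sqrt k%:R * Num.sqrt (SR T * T%:R) = 2 * (x * T%:R).
  rewrite -mulrA -sqrtrM ?ler0n // (mulrA k%:R) -xx -(mulrA (x ^+ 2)) -expr2 -exprMn.
  by rewrite sqrtr_sqr gtr0_norm ?mulr_gt0.
have xT0 : 0 < x * T%:R by rewrite mulr_gt0.
rewrite /explore_rate -/x minElt; case: ltP => [x1|x1].
  by rewrite subrr mul0r; nra.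
(* The rate balances the two costs: exploration and the scaled regret are both [x * T]. *)
have -> : k%:R / x * SR T = x * T%:R.
  by rewrite mulrAC -xx; field; rewrite gt_eqF.
nra.
Qed.

(** From [SR T <= (e / 2) ^+ 2 * T] the root is at most [e / 2 * T]; the other half of [e * T]
    eventually absorbs the 1. *)
Lemma sqrt_littleo {R : realType} (SR : nat -> R) :
  SR =o_\oo (fun T => T%:R : R) ->
  (fun T => Num.sqrt (SR T * T%:R) + 1) =o_\oo (fun T => T%:R : R).
Proof.
move=> /eqoP oSR; apply/eqoP => e e0.
have e20 : 0 < e / 2 by rewrite divr_gt0.
have e40 : 0 < (e / 2) ^+ 2 by rewrite exprn_gt0.
near=> T.
have T0 : 0 <= T%:R :> R by rewrite ler0n.
have le1 : 1 <= e / 2 * T%:R.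
  have : (e / 2)^-1 <= T%:R by near: T; exact: nbhs_infty_ger.
  by move=> /(ler_wpM2l (ltW e20)); rewrite mulfV ?gt_eqF.
have leSR : `|SR T| <= (e / 2) ^+ 2 * `|T%:R : R| by near: T; exact: oSR.
have : Num.sqrt (SR T * T%:R) <= e / 2 * T%:R.
  have <- : Num.sqrt ((e / 2 * T%:R) ^+ 2) = e / 2 * T%:R.
    by rewrite sqrtr_sqr ger0_norm // mulr_ge0 // ltW.
  rewrite ler_wsqrtr //.
  rewrite exprMn [T%:R ^+ 2]expr2 mulrA ler_wpM2r //.
  by apply: le_trans (ler_norm _) _; rewrite (ger0_norm T0) in leSR.
rewrite ger0_norm ?addr_ge0 // ?sqrtr_ge0 // (ger0_norm T0).
by move=> le2; lra.
Unshelve. all: by end_near.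
Qed.

Theorem theorem11 (R : realType) (k : nat) (hk : (0 < k)%N)
    (base : base_alg R k) (M d : nat -> nat) (SR : nat -> R)
    (base_dist : forall c N ls, is_dist (base c N ls))
    (base_monotone : forall c N, 0 < c -> fi_monotone N (base c N))
    (base_noregret : no_external_regret base)
    (Md_range : forall T, (0 < T)%N ->
       (0 < d T)%N /\ (M T ^ (d T).-1 <= T <= M T ^ d T)%N)
    (SR_pos : forall T, (0 < T)%N -> 0 < SR T)
    (SR_bound : forall (T : nat) (c a : R) (ls : T.-tuple (vec R k)),
       (0 < T)%N -> 0 < c -> losses_in a c ls ->
       fi_swap_regret (tree_swap base c (M T) (d T)) ls <= c * SR T)
    (SR_sublinear : SR =o_\oo (fun T => T%:R : R)) :
  (forall (T : nat) (disp : measure_display) (Omega : measurableType disp)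
      (P : probability Omega R) (coin : coinT k Omega) (draw : drawT R k Omega),
      (0 < T)%N ->
      mono_bandit_randomness P T (explore_rate k SR T) coin draw ->
      monotone_mechanism P T
        (mono_bandit (mb_tree_swap_alg base M d SR T) (explore_rate k SR T)
           coin draw)) /\
  (exists g : nat -> R, g =o_\oo (fun T => T%:R : R) /\
    forall (T : nat) (disp : measure_display) (Omega : measurableType disp)
      (P : probability Omega R) (coin : coinT k Omega) (draw : drawT R k Omega)
      (adv : adversary R k (option 'I_k * 'I_k)),
      (0 < T)%N ->
      mono_bandit_randomness P T (explore_rate k SR T) coin draw ->
      (forall h i, 0 <= adv h i <= 1) ->
      (swap_regret P
         (mono_bandit (mb_tree_swap_alg base M d SR T) (explore_rate k SR T)
            coin draw)
         (mono_bandit_bits (mb_tree_swap_alg base M d SR T)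
            (explore_rate k SR T) coin draw) adv T
       <= (2 * Num.sqrt k%:R * g T)%:E)%E).
Proof.
have eps01 T (T0 : (0 < T)%N) := explore_rate_bounds hk T0 (SR_pos _ T0).
have c_gt0 T : (0 < T)%N -> 0 < k%:R / explore_rate k SR T.
  by move=> T0; have /andP[e0 _] := eps01 _ T0; rewrite divr_gt0 ?ltr0n.
have dA T ls : (0 < T)%N -> is_dist (mb_tree_swap_alg base M d SR T ls).
  by move=> T0; apply: tree_swap_dist base_dist _; case: (Md_range _ T0).
split=> [T disp Omega P coin draw T0 rnd|].
  apply: mono_bandit_monotone rnd => //; [exact: eps01|by move=> ls; apply: dA|].
  move=> ls ls' t i szls eqls le_t.
  apply: tree_swap_monotone szls eqls le_t; last exact/base_monotone/c_gt0.
  (* [M T] is positive, since otherwise [M T ^ d T] would be 0 and smaller than [T]. *)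
  have [d0 /andP[_]] := Md_range _ T0.
  by case: (M T) => //; rewrite exp0n // leqNgt T0.
(* The [+ 1] is multiplied by [2 * sqrt k], which is at least 2, and so pays for the additive 2 of
   the first round. *)
exists (fun T => Num.sqrt (SR T * T%:R) + 1); split.
  exact: sqrt_littleo.
move=> T disp Omega P coin draw adv T0 rnd adv01.
apply: le_trans (mono_bandit_swap_regret hk (eps01 _ T0)
  (B := k%:R / explore_rate k SR T * SR T) _ _ _ rnd adv01) _.
- by move=> ls; apply: dA.
- by apply: mulr_ge0 (ltW (SR_pos _ T0)); apply/ltW/c_gt0.
- by move=> ls; apply: SR_bound => //; apply: c_gt0.
rewrite lee_fin mulrDr lerD ?explore_rate_balance ?SR_pos // mulr1.
by rewrite -[leLHS]mulr1 ler_wpM2l // -{1}sqrtr1 ler_wsqrtr // ler1n.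
Qed.
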